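(* Let $(\mathcal S,\mathcal A,C,f,r,\gamma)$ together with a policy class $\Pi$ be a compactly restrictable metric policy optimization problem (CR-MPOP) such that $C(s)$ is closed for every $s\in\mathcal S$, $\mathrm{Graph}(C)$ is closed in $\mathcal S\times\mathcal A$, $f$ and $r$ are continuous, and $\Pi$ is the set of all measurable selectors of $C$. Then there exists a metric policy optimization problem (MPOP) given by an MDP $(\mathcal S_0,\mathcal A_0,C_0,f_0,r_0,\gamma)$ and a policy class $\Pi_0$ such that: (a) $\mathcal S_0\subseteq\mathcal S$ is rendered forward-invariant by a continuous policy in $\Pi$, $\mathcal A_0\subseteq\mathcal A$, $C_0:\mathcal S_0\to\mathcal P(\mathcal A_0)$ satisfies $C_0(s)\subseteq C(s)$ for all $s\in\mathcal S_0$, $f_0=f|_{\mathrm{Graph}(C_0)}$, $r_0=r|_{\mathrm{Graph}(C_0)}$, and $$\Pi_0=\{\pi|_{\mathcal S_0}:\ \pi\in\Pi,\ \pi(\mathcal S_0)\subseteq\mathcal A_0,\ f_\pi(\mathcal S_0)\subseteq\mathcal S_0\},$$ where each $\pi|_{\mathcal S_0}$ is regarded as a map $\mathcal S_0\to\mathcal A_0$; (b) $C_0$ has compact values and is upper hemicontinuous, $f_0$ is continuous, $r_0$ is upper semicontinuous and bounded, $\Pi_0$ is the set of all measurable selectors of $C_0$, and for each $(s,a)\in\mathrm{Graph}(C_0)$ there is $\pi_{s,a}\in\Pi_0$ with $\pi_{s,a}(s)=a$.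
   Context: All metric spaces are nonempty and carry their Borel $\sigma$-algebras; subsets of metric spaces and products of metric spaces are regarded as metric spaces in the usual way. For metric spaces $X,Y$, a correspondence is a map $C:X\to\mathcal P(Y)$ into the powerset of $Y$, with $\mathrm{Graph}(C)=\{(x,y)\in X\times Y: y\in C(x)\}$. If $C(x)\neq\emptyset$ for all $x$, a selector of $C$ is a function $g:X\to Y$ with $g(x)\in C(x)$ for all $x$. $C$ is upper hemicontinuous if for every closed $B\subseteq Y$ the lower preimage $\{x\in X: C(x)\cap B\ne\emptyset\}$ is closed. A bounded measurable function $g:X\to\mathbb R$ is upper semicontinuous if $\{x: g(x)\ge c\}$ is closed in $X$ for every $c\in\mathbb R$. A (metric) MDP is a tuple $(\mathcal S,\mathcal A,C,f,r,\gamma)$ with $\mathcal S,\mathcal A$ nonempty separable metric spaces, $C:\mathcal S\to\mathcal P(\mathcal A)$ with $C(s)\ne\emptyset$ for all $s$, $f:\mathrm{Graph}(C)\to\mathcal S$ and $r:\mathrm{Graph}(C)\to\mathbb R$ measurable, and $\gamma\in[0,1)$. A policy is a selector $\pi$ of $C$. Put $f_\pi(s)=f(s,\pi(s))$, $r_\pi(s)=r(s,\pi(s))$, and let $f_\pi^t$ be the $t$-fold composition of $f_\pi$. Let $\mathcal S_\pi$ be the set of $s\in\mathcal S$ for which $\sum_{t=0}^\infty\gamma^t r_\pi(f_\pi^t(s))$ converges absolutely. A set of policies $\Pi$ admits a partial order if $\mathcal S_\pi=\mathcal S$ for all $\pi\in\Pi$. An MPOP is a pair of an MDP and a policy class admitting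 a partial order. A policy $\pi$ renders $\mathcal S_0\subseteq\mathcal S$ forward-invariant if $f_\pi(\mathcal S_0)\subseteq\mathcal S_0$. A CR-MPOP is an MPOP (with MDP $(\mathcal S,\mathcal A,C,f,r,\gamma)$ and policy class $\Pi$) for which there exist a nonempty compact subset of $\mathcal S$ and a continuous policy $\pi_0\in\Pi$ rendering that subset forward-invariant. *)

(* Defs.v *)
From HB Require Import structures.
From mathcomp Require Import all_boot all_order all_algebra.
From mathcomp Require Import all_classical all_reals all_analysis.
Set Implicit Arguments.
Unset Strict Implicit.
Unset Printing Implicit Defensive.
Import Order.TTheory GRing.Theory Num.Theory numFieldNormedType.Exports.
Local Open Scope classical_set_scope.
Local Open Scope ring_scope.

Section subspace_metric.
Context {R : realType} {X : metricType R} (D : set X).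

Let dist (x y : D) : R := mdist (set_val x) (set_val y).

Let dist_ge0 x y : 0 <= dist x y.
Proof. exact: mdist_ge0. Qed.

Let dist_positivity x y : dist x y = 0 -> x = y.
Proof. by move=> /mdist_positivity; exact: val_inj. Qed.

Let ballEdist (x : D) (d : R) : ball x d = [set y | dist x y < d].
Proof. by rewrite -initial_ballE ballEmdist. Qed.

HB.instance Definition _ :=
  @PseudoMetric_isMetric.Build R (D : Type) dist dist_ge0 dist_positivity
    ballEdist.

End subspace_metric.

Definition separable (X : topologicalType) :=
  exists2 D : set X, countable D & dense D.

(* Borel measurability. The library equips the generated sigma-algebra with a
   measurable structure only on a [pointedType], whence the explicit form. The
   domain is always a whole type, possibly a subspace [set_type D] with its own
   Borel sets, so that measurability never hinges on [D] being Borel. *)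
Definition borel_fun (X Y : topologicalType) (g : X -> Y) :=
  forall B : set Y, <<s @open Y >> B -> <<s @open X >> (g @^-1` B).

Definition upper_semicontinuous (R : realType) (X : topologicalType)
  (g : X -> R) := forall c : R, closed [set x | c <= g x].

Section correspondences.
Context {X Y : topologicalType} (C : X -> set Y).

Definition Graph : set (X * Y) := [set xy | C xy.1 xy.2].

Definition graph_pt (x : X) (y : Y) (Cxy : C x y) : Graph :=
  exist _ (x, y) (mem_set (Cxy : Graph (x, y))).

Definition selector (g : X -> Y) := forall x, C x (g x).

Definition measurable_selectors : set (X -> Y) :=
  [set g | selector g /\ borel_fun g].

Definition upper_hemicontinuous :=
  forall B : set Y, closed B -> closed [set x | C x `&` B !=set0].

End correspondences.

(* Elements of a [metricType] need not exist, hence the nonemptiness fields. *)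
Record mdp (R : realType) (S A : metricType R) := Mdp {
  corr : S -> set A ;
  trans : Graph corr -> S ;
  reward : Graph corr -> R ;
  discount : R ;
  state_nonempty : [set: S] !=set0 ;
  action_nonempty : [set: A] !=set0 ;
  state_separable : separable S ;
  action_separable : separable A ;
  corr_nonempty : forall s, corr s !=set0 ;
  trans_measurable : borel_fun trans ;
  reward_measurable : borel_fun reward ;
  discount_ge0 : 0 <= discount ;
  discount_lt1 : discount < 1 }.

Record policy (R : realType) (S A : metricType R) (M : mdp S A) := Policy {
  policy_fun :> S -> A ;
  policy_selector : selector (corr M) policy_fun }.

Section policies.
Context {R : realType} {S A : metricType R} {M : mdp S A}.

Definition closed_loop (p : policy M) (s : S) : S :=
  trans (graph_pt (policy_selector p s)).

Definition policy_reward (p : policy M) (s : S) : R :=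
  reward (graph_pt (policy_selector p s)).

Definition abs_cvg_states (p : policy M) : set S :=
  [set s | cvgn [normed series (fun t : nat =>
     discount M ^+ t * policy_reward p (iter t (closed_loop p) s))]].

Definition admits_partial_order (Pi : set (policy M)) :=
  forall p, Pi p -> abs_cvg_states p = [set: S].

Definition forward_invariant (p : policy M) (D : set S) :=
  closed_loop p @` D `<=` D.

End policies.

Record mpop (R : realType) (S A : metricType R) := Mpop {
  mpop_mdp :> mdp S A ;
  policies : set (policy mpop_mdp) ;
  policies_partial_order : admits_partial_order policies }.

Arguments policies {R S A} m _.

Section mpop_predicates.
Context {R : realType} {S A : metricType R}.

(* The policy class as a set of plain functions, so that classes over different
   decision processes, and sets of selectors, can be compared with it. *)
Definition policy_class (P : mpop S A) : set (S -> A) :=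
  @policy_fun R S A P @` policies P.

Definition compactly_restrictable (P : mpop S A) :=
  exists K : set S, [/\ K !=set0, compact K &
    exists p : policy P,
      [/\ policies P p, continuous p & forward_invariant p K]].

(* Plain functions [S0 -> A0], not required to select from a correspondence on
   [S0]; [q] is the restriction of [p] with codomain cut down to [A0]. *)
Definition restricted_policies (P : mpop S A) (S0 : set S) (A0 : set A) :
    set (S0 -> A0) :=
  [set q | exists p : policy P,
    [/\ policies P p, p @` S0 `<=` A0, forward_invariant p S0 &
        forall s : S0, set_val (q s) = p (set_val s)]].

End mpop_predicates.

Arguments restricted_policies {R S A} P S0 A0.

(* Main.v *)
Require Import Defs.
From HB Require Import structures.
From mathcomp Require Import all_boot all_order all_algebra.
From mathcomp Require Import all_classical all_reals all_analysis.
Set Implicit Arguments.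
Unset Strict Implicit.
Unset Printing Implicit Defensive.
Import Order.TTheory GRing.Theory Num.Theory numFieldNormedType.Exports.
Local Open Scope classical_set_scope.
Local Open Scope ring_scope.

(** A compact forward-invariant set [K] and a continuous policy [p0] that keeps
    it invariant already determine the restricted problem. Take [K] for the
    states and the compact image [p0(K)] for the actions, and allow at a state
    [s] exactly those actions of [C(s)] in [p0(K)] after which the next state is
    still in [K] ([restricted_corr]). The values of this correspondence are
    nonempty, because [p0(s)] is always allowed.

    All the regularity follows from compactness. The set of pairs of
    [Graph(C)] that the transition sends into [K] is closed in [Graph(C)], hence
    closed in the full product since [Graph(C)] is; the restricted graph is its
    trace on [K * p0(K)] ([closed_restricted_graph]), so it is compact. Its
    sections are then compact, its projections of closed sets are closed
    ([closed_graph_uhc]), and the continuous reward is bounded on it. A bounded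
    reward makes every discounted sum converge absolutely
    ([bounded_reward_abs_cvg]), so any set of policies admits a partial order.

    The two descriptions of the policy class agree
    ([restricted_policies_selectors]). The restriction of an admissible policy
    is a measurable selector of the restricted correspondence because it keeps
    [K] invariant. Conversely, a measurable selector on [K] is prolonged by [p0]
    outside [K]; this is measurable because [K] is closed, and it is a selector
    of [C], hence a policy of the given class. Changing the restriction of [p0]
    at a single state gives the selectors that pass through a prescribed point
    of the graph ([measurable_selector_through]). *)

(** * Subspaces *)

Lemma continuous_set_val (X : topologicalType) (D : set X) :
  continuous (set_val : D -> X).
Proof. exact: initial_continuous. Qed.

Lemma continuous_to_set_type (X Y : topologicalType) (D : set Y) (f : X -> D) :
  continuous (set_val \o f) -> continuous f.
Proof. exact: continuous_comp_initial. Qed.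

(** The image under the inclusion of a filter on [D] clusters in [D], and the
    open sets of [D] are traces, so the filter clusters at the same point. *)
Lemma compact_set_type (X : topologicalType) (D : set X) :
  compact D -> compact [set: D].
Proof.
move=> cD F PF _.
have FD : (set_val @ F) D by apply: (@filterE _ F) => u; exact: set_valP.
have [x [Dx clx]] := cD _ _ FD.
exists (exist _ x (mem_set Dx)); split=> // U V FU [_ [[W oW <-] Wx WV]].
have FW : (set_val @ F) (set_val @` U).
  by apply: (@filterS _ F _ U) => // u Uu; exists u.
have [_ [[u Uu <-] Wu]] := clx _ W FW (open_nbhs_nbhs (conj oW Wx)).
by exists u; split=> //; exact: WV.
Qed.

(** A relatively closed subset of a closed set is closed; this turns closed
    conditions on a graph into closed subsets of the ambient product. *)
Lemma closed_image_set_val (X : topologicalType) (D : set X) (B : set D) :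
  closed D -> closed B -> closed (set_val @` B).
Proof.
move=> cD cB; have [W oW WB] := closed_openC cB.
have WE u : W (set_val u) = ~ B u by rewrite -[LHS]/((_ @^-1` W) u) WB.
have -> : set_val @` B = D `&` ~` W.
  apply/seteqP; split=> [_ [u Bu <-]|x [Dx nWx]].
    by split; [exact: set_valP|rewrite /setC /= WE].
  pose u : D := exist _ x (mem_set Dx).
  by exists u => //; apply: contrapT; rewrite -WE.
by apply: closedI => //; exact: open_closedC.
Qed.

(** A countable dense set of the ambient space may miss [D] altogether, so for
    each of its points [d] and each radius [1/(n+1)] one point of [D] within
    that radius of [d] is chosen, whenever there is one. *)
Lemma separable_subspace (R : realType) (X : metricType R) (D : set X) :
  separable X -> separable D.
Proof.
case=> E cE dE.
pose near_pt (p : X * nat) : set D :=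
  if pselect (exists u : D, ball p.1 p.2.+1%:R^-1 (set_val u)) is left H
  then [set projT1 (cid H)] else set0.
exists (\bigcup_(p in E `*` [set: nat]) near_pt p).
  apply: bigcup_countable => [|p _]; first exact: countableX.
  by rewrite /near_pt; case: pselect => // H; exact: countable1.
move=> U [u Uu] [W oW WU].
have Wu : W (set_val u) by rewrite -WU in Uu.
have /nbhs_ballP[e /= e0 eW] : nbhs (set_val u) W by exact: open_nbhs_nbhs.
(* The radius is below [e / 2]: one step leads from [u] to [d], and a second
   one from [d] to the chosen point. *)
have [n] : exists n, 0 + n.+1%:R^-1 < e / 2.
  by apply: ltr_add_invr; rewrite divr_gt0.
rewrite add0r => ne; pose r : R := n.+1%:R^-1.
have r0 : 0 < r by rewrite invr_gt0.
have [d [/interior_subset ud Ed]] : (ball (set_val u) r)° `&` E !=set0.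
  apply: dE; last exact: open_interior.
  by exists (set_val u); exact: nbhsx_ballx.
have H : exists v : D, ball d r (set_val v) by exists u; exact: ball_sym.
have dv : ball d r (set_val (projT1 (cid H))) := projT2 (cid H).
exists (projT1 (cid H)); split.
  rewrite -WU; apply: eW; apply: (@le_ball _ _ _ (r + r)).
    by rewrite [e in leRHS]splitr lerD// ltW.
  exact: ball_triangle ud dv.
exists (d, n) => //; rewrite /near_pt; case: pselect => [H'|//].
by rewrite (Prop_irrelevance H H').
Qed.

(** * Borel sets and Borel functions *)

Lemma borel_open (X : topologicalType) (U : set X) :
  open U -> <<s @open X >> U.
Proof. by move=> oU; apply: sub_sigma_algebra. Qed.

Lemma borel_setC (X : topologicalType) (U : set X) :
  <<s @open X >> U -> <<s @open X >> (~` U).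
Proof.
move=> bU; rewrite -setTD.
by have [_ bC _] := smallest_sigma_algebra [set: X] (@open X); exact: bC.
Qed.

Lemma borel_closed (X : topologicalType) (B : set X) :
  closed B -> <<s @open X >> B.
Proof.
move=> cB; rewrite -[B]setCK; apply: borel_setC; apply: borel_open.
exact: closed_openC.
Qed.

Lemma borel_setU (X : topologicalType) (U V : set X) :
  <<s @open X >> U -> <<s @open X >> V -> <<s @open X >> (U `|` V).
Proof.
move=> bU bV; rewrite -bigcup2E; apply: sigma_algebra_bigcup => -[|[|i]] //=.
by apply: borel_open; exact: open0.
Qed.

Lemma borel_setI (X : topologicalType) (U V : set X) :
  <<s @open X >> U -> <<s @open X >> V -> <<s @open X >> (U `&` V).
Proof.
move=> bU bV; rewrite -[_ `&` _]setCK setCI.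
by apply: borel_setC; apply: borel_setU; exact: borel_setC.
Qed.

Lemma borel_fun_continuous (X Y : topologicalType) (g : X -> Y) :
  continuous g -> borel_fun g.
Proof.
move=> /continuousP cg B bB.
have := @smallest_sub _ (sigma_algebra [set: Y]) open
  [set B : set Y | <<s @open X >> (g @^-1` B)] _ _ B bB; apply.
- split=> /=.
  + by rewrite preimage_set0; apply: borel_open; exact: open0.
  + by move=> U bU; rewrite setTD preimage_setC; exact: borel_setC.
  + by move=> F bF; rewrite preimage_bigcup; exact: sigma_algebra_bigcup.
- by move=> U oU; apply: borel_open; exact: cg.
Qed.

Lemma borel_fun_comp (X Y Z : topologicalType) (g : X -> Y) (h : Y -> Z) :
  borel_fun g -> borel_fun h -> borel_fun (h \o g).
Proof. by move=> bg bh B bB; apply: (bg (h @^-1` B)); exact: bh. Qed.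

(** Every Borel set of a subspace is the trace of a Borel set: traces of Borel
    sets form a sigma-algebra that contains the relatively open sets. *)
Lemma borel_set_type (X : topologicalType) (D : set X) (B : set D) :
  <<s @open D >> B ->
  exists2 E : set X, <<s @open X >> E & B = set_val @^-1` E.
Proof.
move=> bB.
have [E bE <-] : preimage_set_system setT set_val <<s @open X >> B.
  apply: (@smallest_sub _ (sigma_algebra [set: D]) open _ _ _ B bB).
    exact/sigma_algebra_preimage/smallest_sigma_algebra.
  by move=> _ [W oW <-]; exists W; [exact: borel_open|rewrite setTI].
by exists E; rewrite ?setTI.
Qed.

Lemma borel_to_set_type (X Y : topologicalType) (D : set Y) (g : X -> D) :
  borel_fun (set_val \o g) -> borel_fun g.
Proof. by move=> bg B /borel_set_type[E bE ->]; exact: bg. Qed.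

(** A function on the subspace [D] is a function on a sigma-type, hence the
    proof that must be supplied to apply it; [h] is used off [D]. *)
Definition extend (X Y : Type) (D : set X) (g : D -> Y) (h : X -> Y) (x : X) :=
  if pselect (D x) is left Dx then g (exist _ x (mem_set Dx)) else h x.

Lemma extend_in (X Y : Type) (D : set X) (g : D -> Y) (h : X -> Y) (u : D) :
  extend g h (set_val u) = g u.
Proof.
rewrite /extend; case: pselect => [Du|]; last by case; exact: set_valP.
by congr g; exact: val_inj.
Qed.

Lemma extend_out (X Y : Type) (D : set X) (g : D -> Y) (h : X -> Y) (x : X) :
  ~ D x -> extend g h x = h x.
Proof. by rewrite /extend; case: pselect. Qed.

(** On [D] the preimage of a Borel set is a trace of a Borel set of [X], and it
    is Borel in [X] because [D] is. *)
Lemma borel_extend (X Y : topologicalType) (D : set X) (g : D -> Y)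
    (h : X -> Y) :
  closed D -> borel_fun g -> borel_fun h -> borel_fun (extend g h).
Proof.
move=> cD bg bh B bB; have [E bE gE] := borel_set_type (bg _ bB).
have -> : extend g h @^-1` B = (D `&` E) `|` (~` D `&` h @^-1` B).
  apply/seteqP; split=> [x Bx|x [[Dx Ex]|[nDx Bhx]]].
  - have [Dx|nDx] := pselect (D x); [left|right]; split=> //.
      pose u : D := exist _ x (mem_set Dx).
      suff : (g @^-1` B) u by rewrite gE.
      by rewrite /preimage /= -(extend_in g h).
    by move: Bx; rewrite /preimage /= extend_out.
  - have : (g @^-1` B) (exist _ x (mem_set Dx)) by rewrite gE.
    by rewrite /preimage /= -(extend_in g h).
  - by rewrite /preimage /= extend_out.
apply: borel_setU; apply: borel_setI => //.
- exact: borel_closed.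
- by apply: borel_setC; exact: borel_closed.
- exact: bh.
Qed.

(** * Continuous functions and correspondences on compact spaces *)

Lemma continuous_usc (R : realType) (X : topologicalType) (g : X -> R) :
  continuous g -> upper_semicontinuous g.
Proof.
move=> /continuous_closedP cg c.
exact: (cg [set y | c <= y] (@closed_ge R c)).
Qed.

Lemma compact_bounded_fun (R : realType) (X : topologicalType) (g : X -> R) :
  compact [set: X] -> continuous g -> bounded_fun g.
Proof.
move=> cX cg.
have /compact_bounded [M [Mr MP]] :=
  continuous_compact (continuous_subspaceT cg) cX.
by exists M; split=> // N /MP gN x _; apply: gN; exists x.
Qed.

(** The lower preimage of [B] is the projection to [X] of the compact set
    [Graph C] cut by [B], so it is compact. *)
Lemma closed_graph_uhc (X Y : topologicalType) (C : X -> set Y) :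
  hausdorff_space X -> compact [set: X] -> compact [set: Y] ->
  closed (Graph C) -> upper_hemicontinuous C.
Proof.
move=> hX cX cY cG B cB.
have -> : [set x | C x `&` B !=set0] =
    fst @` (Graph C `&` snd @^-1` B).
  apply/seteqP; split=> [x [y [Cxy By]]|_ [[x y] [Cxy By] <-]].
    by exists (x, y).
  by exists y.
apply: compact_closed => //; apply: continuous_compact.
  by apply: continuous_subspaceT => x; exact: cvg_fst.
apply: (@subclosed_compact _ _ ([set: X] `*` [set: Y])) => //.
  apply: closedI => //.
  by apply: preimage_closed => // x _; exact: cvg_snd.
exact: compact_setX.
Qed.

Lemma closed_graph_values (X Y : topologicalType) (C : X -> set Y) :
  closed (Graph C) -> forall x, closed (C x).
Proof.
move=> cG x.
have -> : C x = (fun y => (x, y)) @^-1` Graph C by [].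
by apply: preimage_closed => // y _; apply: cvg_pair; [exact: cvg_cst|].
Qed.

Lemma compact_graph (X Y : topologicalType) (C : X -> set Y) :
  compact [set: X] -> compact [set: Y] -> closed (Graph C) ->
  compact [set: Graph C].
Proof.
move=> cX cY cG; apply: compact_set_type.
apply: (@subclosed_compact _ _ ([set: X] `*` [set: Y])) => //.
exact: compact_setX.
Qed.

(** * Discounted sums *)

(** Comparison with the geometric series of ratio the discount factor. *)
Lemma bounded_reward_abs_cvg (R : realType) (S A : metricType R)
    (M : mdp S A) (p : policy M) :
  bounded_fun (@reward R S A M) -> abs_cvg_states p = [set: S].
Proof.
move=> [N [_ /(_ (N + 1))]]; rewrite ltrDl ltr01 => /(_ isT) rB.
set B := N + 1 in rB; apply/seteqP; split=> // s _.
have dn : `|discount M| < 1.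
  by rewrite ger0_norm ?discount_lt1 ?discount_ge0.
have r_le t : `|policy_reward p (iter t (closed_loop p) s)| <= B.
  exact: (rB (graph_pt _) I).
have B0 : 0 <= B by apply: le_trans (r_le 0); exact: normr_ge0.
apply: (@series_le_cvg R _ (geometric B (discount M))) => [t|t|t|].
- exact: normr_ge0.
- by rewrite /geometric /= mulr_ge0 ?exprn_ge0 ?discount_ge0.
- rewrite /geometric /= normrM mulrC normrX (ger0_norm (discount_ge0 M)).
  by apply: ler_wpM2r; [rewrite exprn_ge0 ?discount_ge0|exact: r_le].
- exact: is_cvg_geometric_series.
Qed.

(** * Restriction of a decision process *)

Lemma graph_pt_eq (X Y : topologicalType) (C : X -> set Y) (g : Graph C)
    (x : X) (y : Y) (Cxy : C x y) :
  set_val g = (x, y) -> g = graph_pt Cxy.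
Proof. by move=> gxy; apply: val_inj. Qed.

Section restriction.
Context {R : realType} {S A : metricType R} (M : mdp S A)
  (S0 : set S) (A0 : set A).

Definition pair_inclusion (z : S0 * A0) : S * A := (set_val z.1, set_val z.2).

(** Quantifying over the points of [Graph (corr M)], rather than over proofs of
    membership in [corr M], makes the restricted graph the preimage of an
    image, from which its closedness follows; [restricted_corrP] gives the
    pointwise form. *)
Definition restricted_corr (s : S0) : set A0 :=
  [set a | (set_val @` (@trans R S A M @^-1` S0)) (pair_inclusion (s, a))].

Lemma restricted_corrP (s : S0) (a : A0) :
  restricted_corr s a <->
  exists C : corr M (set_val s) (set_val a), S0 (trans (graph_pt C)).
Proof.
split=> [[g Sg gE]|[C SC]]; last by exists (graph_pt C).
have C : corr M (set_val s) (set_val a).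
  by have : Graph (corr M) (set_val g) := set_valP g; rewrite gE.
by exists C; rewrite -(graph_pt_eq C gE).
Qed.

Lemma continuous_pair_inclusion : continuous pair_inclusion.
Proof.
move=> z; apply: cvg_pair.
  apply: (@continuous_comp _ _ _ fst set_val); first exact: cvg_fst.
  exact: continuous_set_val.
apply: (@continuous_comp _ _ _ snd set_val); first exact: cvg_snd.
exact: continuous_set_val.
Qed.

Lemma closed_restricted_graph :
  closed (Graph (corr M)) -> closed S0 -> continuous (@trans R S A M) ->
  closed (Graph restricted_corr).
Proof.
move=> cG cS0 /continuous_closedP cf.
have -> : Graph restricted_corr =
    pair_inclusion @^-1` (set_val @` (@trans R S A M @^-1` S0)).
  by apply/seteqP; split=> -[].
apply: preimage_closed => [z _|]; first exact: continuous_pair_inclusion.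
by apply: closed_image_set_val => //; exact: cf.
Qed.

Lemma graph_inclusion_subproof (z : Graph restricted_corr) :
  Graph (corr M) (pair_inclusion (set_val z)).
Proof.
have : restricted_corr (set_val z).1 (set_val z).2 := set_valP z.
by move=> /restricted_corrP [].
Qed.

Definition graph_inclusion (z : Graph restricted_corr) : Graph (corr M) :=
  exist _ (pair_inclusion (set_val z)) (mem_set (graph_inclusion_subproof z)).

Lemma trans_graph_inclusion (z : Graph restricted_corr) :
  S0 (trans (graph_inclusion z)).
Proof.
case: (set_valP z) => g Sg gE.
rewrite (_ : graph_inclusion z = g) //; apply: val_inj.
by rewrite -[RHS]/(set_val g) gE; case: z {g Sg gE} => -[].
Qed.

Lemma continuous_graph_inclusion : continuous graph_inclusion.
Proof.
apply: continuous_to_set_type => z.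
apply: (@continuous_comp _ _ _ set_val pair_inclusion).
  exact: continuous_set_val.
exact: continuous_pair_inclusion.
Qed.

Definition restricted_trans (z : Graph restricted_corr) : S0 :=
  exist _ (trans (graph_inclusion z)) (mem_set (trans_graph_inclusion z)).

Definition restricted_reward (z : Graph restricted_corr) : R :=
  reward (graph_inclusion z).

Lemma continuous_restricted_trans :
  continuous (@trans R S A M) -> continuous restricted_trans.
Proof.
move=> cf; apply: continuous_to_set_type => z.
apply: (@continuous_comp _ _ _ graph_inclusion (@trans R S A M)).
  exact: continuous_graph_inclusion.
exact: cf.
Qed.

Lemma continuous_restricted_reward :
  continuous (@reward R S A M) -> continuous restricted_reward.
Proof.
move=> cr z.
apply: (@continuous_comp _ _ _ graph_inclusion (@reward R S A M)).
  exact: continuous_graph_inclusion.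
exact: cr.
Qed.

End restriction.

Definition restricted_mdp (R : realType) (S A : metricType R) (M : mdp S A)
    (S0 : set S) (A0 : set A) (cf : continuous (@trans R S A M))
    (cr : continuous (@reward R S A M)) (S0n0 : [set: S0] !=set0)
    (A0n0 : [set: A0] !=set0)
    (Cn0 : forall s, @restricted_corr R S A M S0 A0 s !=set0) : mdp S0 A0 :=
  Mdp S0n0 A0n0
    (separable_subspace S0 (state_separable M))
    (separable_subspace A0 (action_separable M)) Cn0
    (borel_fun_continuous (continuous_restricted_trans cf))
    (borel_fun_continuous (continuous_restricted_reward cr))
    (discount_ge0 M) (discount_lt1 M).

(** * Measurable selectors and policies *)

(** Redefining [q0] at the single point [x], a closed set, keeps it
    measurable. *)
Lemma measurable_selector_through (X Y : topologicalType) (C : X -> set Y)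
    (q0 : X -> Y) (x : X) (y : Y) :
  hausdorff_space X -> measurable_selectors C q0 -> C x y ->
  exists2 q, measurable_selectors C q & q x = y.
Proof.
move=> hX [C0 b0] Cxy.
pose q := extend (fun _ : [set x] => y) q0.
have qx : q x = y.
  exact: (extend_in _ _ (exist _ x (mem_set (erefl : [set x] x)))).
exists q => //; split=> [z|].
  by have [->|nzx] := pselect (z = x); [rewrite qx|rewrite /q extend_out].
apply: borel_extend => //.
  exact: (accessible_closed_set1 (hausdorff_accessible hX)).
by apply: borel_fun_continuous; exact: cst_continuous.
Qed.

Lemma policy_class_borel (R : realType) (S A : metricType R) (M : mdp S A) :
  @policy_fun R S A M @` [set p : policy M | borel_fun p] =
    measurable_selectors (corr M).
Proof.
apply/seteqP; split=> [_ [p bp <-]|q [Cq bq]].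
  by split=> //; exact: policy_selector.
by exists (Policy Cq).
Qed.

(** A measurable selector of the restricted correspondence prolonged by [p0]
    off [S0] is a measurable selector of [corr P], because [S0] is closed.
    Since the class consists of all measurable selectors, the prolongation
    belongs to it, and its values on [S0] keep the successors in [S0]. *)
Lemma restricted_policies_selectors (R : realType) (S A : metricType R)
    (P : mpop S A) (S0 : set S) (A0 : set A) (p0 : policy P) :
  policy_class P = measurable_selectors (corr P) -> closed S0 ->
  policies P p0 ->
  restricted_policies P S0 A0 =
    measurable_selectors (@restricted_corr R S A P S0 A0).
Proof.
move=> PE cS0 Pp0; apply/seteqP; split=> q.
  move=> [p [Pp A0p invp qp]]; split=> [s|].
    apply/restricted_corrP.
    have C := policy_selector p (set_val s); rewrite -qp in C.
    exists C; have -> : graph_pt C = graph_pt (policy_selector p (set_val s)).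
      by apply: graph_pt_eq; exact: (congr1 (pair _) (qp s)).
    by apply: invp; exists (set_val s) => //; exact: set_valP.
  apply: borel_to_set_type.
  have -> : set_val \o q = p \o set_val by apply/funext => s; exact: qp.
  apply: borel_fun_comp.
    by apply: borel_fun_continuous; exact: continuous_set_val.
  have [] // : measurable_selectors (corr P) p by rewrite -PE; exists p.
move=> [Cq bq].
pose p := extend (set_val \o q) p0.
have pE s : p (set_val s) = set_val (q s) by rewrite /p extend_in.
have [p1 Pp1 p1E] : policy_class P p.
  rewrite PE; split=> [s|].
    have [S0s|nS0s] := pselect (S0 s); last first.
      by rewrite /p extend_out //; exact: policy_selector.
    rewrite -[s in p s]/(set_val (exist _ s (mem_set S0s) : S0)) pE.
    by have /restricted_corrP[] := Cq (exist _ s (mem_set S0s)).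
  apply: borel_extend => //.
    apply: borel_fun_comp => //.
    by apply: borel_fun_continuous; exact: continuous_set_val.
  have [] // : measurable_selectors (corr P) p0 by rewrite -PE; exists p0.
have p1q s : p1 (set_val s) = set_val (q s) by rewrite p1E pE.
exists p1; split=> //.
- move=> _ [s S0s <-].
  rewrite -[s]/(set_val (exist _ s (mem_set S0s) : S0)) p1q.
  exact: set_valP.
- move=> _ [s S0s <-]; pose u : S0 := exist _ s (mem_set S0s).
  have /restricted_corrP[C] := Cq u.
  have -> : graph_pt C = graph_pt (policy_selector p1 (set_val u)) => //.
  by apply: graph_pt_eq; exact: (congr1 (pair _) (esym (p1q u))).
Qed.

(** * The restricted problem *)

Theorem theorem2 (R : realType) (S A : metricType R) (P : mpop S A)
    (P_restrictable : compactly_restrictable P)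
    (C_closed : forall s : S, closed (corr P s))
    (graph_closed : closed (Graph (corr P)))
    (f_continuous : continuous (@trans R S A P))
    (r_continuous : continuous (@reward R S A P))
    (P_class : policy_class P = measurable_selectors (corr P)) :
  exists (S0 : set S) (A0 : set A) (P0 : mpop S0 A0),
    [/\ discount P0 = discount P,
        (exists p : policy P,
           [/\ policies P p, continuous p & forward_invariant p S0]),
        (forall s : S0, set_val @` corr P0 s `<=` corr P (set_val s)),
        (forall (s : S0) (a : A0) (C0sa : corr P0 s a)
                (Csa : corr P (set_val s) (set_val a)),
           set_val (trans (graph_pt C0sa)) = trans (graph_pt Csa) /\
           reward (graph_pt C0sa) = reward (graph_pt Csa)) &
        policy_class P0 = restricted_policies P S0 A0]
    /\
    [/\ (forall s : S0, compact (corr P0 s)) /\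
          upper_hemicontinuous (corr P0),
        continuous (@trans R S0 A0 P0),
        upper_semicontinuous (@reward R S0 A0 P0) /\
          bounded_fun (@reward R S0 A0 P0),
        policy_class P0 = measurable_selectors (corr P0) &
        forall (s : S0) (a : A0), corr P0 s a ->
          exists2 p : policy P0, policies P0 p & p s = a].
Proof.
have [K [[k Kk] cK [p0 [Pp0 cp0 inv0]]]] := P_restrictable.
pose A0 := p0 @` K.
have cA0 : compact A0.
  by apply: continuous_compact => //; exact: continuous_subspaceT.
have clK : closed K by apply: compact_closed => //; exact: metric_hausdorff.
have KT := compact_set_type cK; have A0T := compact_set_type cA0.
pose C0 := @restricted_corr R S A P K A0.
have RS : restricted_policies P K A0 = measurable_selectors C0.
  exact: restricted_policies_selectors Pp0.
pose q0 (s : K) : A0 :=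
  exist _ (p0 (set_val s)) (mem_set (imageP p0 (set_valP s))).
have q0C : measurable_selectors C0 q0 by rewrite -RS; exists p0; split.
have Kn0 : [set: K] !=set0 by exists (exist _ k (mem_set Kk)).
have A0n0 : [set: A0] !=set0 by have [s _] := Kn0; exists (q0 s).
have Cn0 s : C0 s !=set0 by exists (q0 s); exact: q0C.1.
have cG : closed (Graph C0) by exact: closed_restricted_graph.
pose M0 := restricted_mdp f_continuous r_continuous Kn0 A0n0 Cn0.
have cr0 : continuous (@reward R K A0 M0).
  exact: continuous_restricted_reward.
have br0 : bounded_fun (@reward R K A0 M0).
  by apply: compact_bounded_fun => //; exact: compact_graph.
have po : @admits_partial_order R K A0 M0 [set p : policy M0 | borel_fun p].
  by move=> p _; exact: bounded_reward_abs_cvg.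
pose P0 := Mpop po.
have P0E : policy_class P0 = measurable_selectors C0.
  exact: policy_class_borel.
exists K, A0, P0; split; split=> //.
- by exists p0.
- by move=> s _ [a /restricted_corrP[C _] <-].
- move=> s a C0sa Csa.
  have E : graph_inclusion (graph_pt C0sa) = graph_pt Csa by exact: val_inj.
  by split; rewrite -E.
- by rewrite P0E RS.
- split=> [s|].
    apply: (@subclosed_compact _ _ [set: A0]) => //.
    exact: closed_graph_values.
  by apply: closed_graph_uhc => //; exact: metric_hausdorff.
- exact: continuous_restricted_trans.
- by split=> //; exact: continuous_usc.
- move=> s a C0sa.
  have [q qC qs] :=
    measurable_selector_through (@metric_hausdorff R K) q0C C0sa.
  by move: qC; rewrite -P0E => -[p Pp pq]; exists p => //; rewrite pq.
Qed.
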